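(* $\mathbf{K_N^{Horn}} \prec^w \mathbf{K_N^{Bool}}$, i.e. $\mathbf{K_N^{Horn}}$ is weakly less expressive than $\mathbf{K_N^{Bool}}$ over the class of all Kripke frames.
   Context: Fix a finite set $\tau=\{\alpha_1,\dots,\alpha_N\}$ of modality labels and a countable set $\mathcal P$ of propositional letters. Formulas of $\mathbf{K_N}$ (also written $\mathbf{K_N^{Bool}}$) are generated by $\varphi ::= \top \mid p \mid \neg\varphi \mid \varphi\vee\varphi \mid \Diamond_\alpha\varphi \mid \Box_\alpha\varphi$ ($p\in\mathcal P$, $\alpha\in\tau$); $\wedge,\rightarrow$ are abbreviations and $\bot=\neg\top$. A model $M=(W,\{R_\alpha\}_{\alpha\in\tau},V)$ has a nonempty set $W$ of worlds, relations $R_\alpha\subseteq W\times W$, and a valuation $V:W\to 2^{\mathcal P}$; satisfaction $M,w\Vdash\varphi$ is the standard Kripke semantics ($\Diamond_\alpha\psi$ holds at $w$ iff $\psi$ holds at some $R_\alpha$-successor of $w$; $\Box_\alpha\psi$ holds at $w$ iff $\psi$ holds at all $R_\alpha$-successors). Positive literals: $\lambda ::= \top \mid p \mid \Diamond_\alpha\lambda \mid \Box_\alpha\lambda$. A formula is in clausal form if generated by $\varphi ::= \lambda \mid \neg\lambda \mid \nabla(\neg\lambda_1\vee\dots\vee\neg\lambda_n\vee\lambda_{n+1}\vee\dots\vee\lambda_{n+m}) \mid \varphi\wedge\varphi$, where the $\lambda,\lambda_i$ are positive literals and $\nabla$ is a finite (possibly empty) sequence of boxes $\Box_{\alpha_i}\Box_{\alpha_j}\cdots$.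 $\mathbf{K_N^{Horn}}$ consists of clausal-form formulas in which every clause has $m\le 1$. Expressivity (over all Kripke frames): $\mathbf L\preceq^w\mathbf L'$ if, for a fixed alphabet $\mathcal P$, there is an effective translation $\varphi\mapsto\varphi'$ from $\mathbf L$-formulas over $\mathcal P$ to $\mathbf L'$-formulas over the same $\mathcal P$ such that for every model $M$ and world $w$, $M,w\Vdash\varphi$ iff $M,w\Vdash\varphi'$. $\mathbf L\equiv^w\mathbf L'$ means $\mathbf L\preceq^w\mathbf L'$ and $\mathbf L'\preceq^w\mathbf L$; $\mathbf L\prec^w\mathbf L'$ means $\mathbf L\preceq^w\mathbf L'$ and not $\mathbf L\equiv^w\mathbf L'$. *)

(* Defs.v *)
From HB Require Import structures.
From mathcomp Require Import all_boot.

Set Implicit Arguments.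
Unset Strict Implicit.
Unset Printing Implicit Defensive.

Section Syntax.

Variables (tau : finType) (P : countType).

Inductive formula : Type :=
  | Top
  | Var of P
  | Neg of formula
  | Or of formula & formula
  | Dia of tau & formula
  | Box of tau & formula.

Definition Bot : formula := Neg Top.
Definition And (phi psi : formula) : formula := Neg (Or (Neg phi) (Neg psi)).

(* [pickle] on formulas, obtained from this tree encoding, is the Goedel
   numbering with respect to which translations are effective. *)
Fixpoint tree_of_formula (phi : formula) : GenTree.tree (P + tau) :=
  match phi with
  | Top => GenTree.Node 0 [::]
  | Var p => GenTree.Leaf (inl p)
  | Neg psi => GenTree.Node 1 [:: tree_of_formula psi]
  | Or psi chi => GenTree.Node 2 [:: tree_of_formula psi; tree_of_formula chi]
  | Dia a psi => GenTree.Node 3 [:: GenTree.Leaf (inr a); tree_of_formula psi]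
  | Box a psi => GenTree.Node 4 [:: GenTree.Leaf (inr a); tree_of_formula psi]
  end.

Fixpoint formula_of_tree (t : GenTree.tree (P + tau)) : option formula :=
  match t with
  | GenTree.Node 0 [::] => Some Top
  | GenTree.Leaf (inl p) => Some (Var p)
  | GenTree.Node 1 [:: t1] => omap Neg (formula_of_tree t1)
  | GenTree.Node 2 [:: t1; t2] =>
      obind (fun psi => omap (Or psi) (formula_of_tree t2)) (formula_of_tree t1)
  | GenTree.Node 3 [:: GenTree.Leaf (inr a); t1] =>
      omap (Dia a) (formula_of_tree t1)
  | GenTree.Node 4 [:: GenTree.Leaf (inr a); t1] =>
      omap (Box a) (formula_of_tree t1)
  | _ => None
  end.

Lemma tree_of_formulaK : pcancel tree_of_formula formula_of_tree.
Proof. by elim=> //= [? ->|? -> ? ->|? ? ->|? ? ->]. Qed.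

HB.instance Definition _ := Countable.copy formula (pcan_type tree_of_formulaK).

Fixpoint pos_lit (phi : formula) : bool :=
  match phi with
  | Top | Var _ => true
  | Dia _ psi | Box _ psi => pos_lit psi
  | Neg _ | Or _ _ => false
  end.

(* The empty disjunction is [Bot], that is, the one-element clause [Neg Top]. *)
Definition disj (s : seq formula) : formula :=
  if s is phi :: s' then foldl Or phi s' else Bot.

Definition boxes (nabla : seq tau) (phi : formula) : formula :=
  foldr Box phi nabla.

Definition clause (neg pos : seq formula) : formula :=
  disj ([seq Neg l | l <- neg] ++ pos).

Inductive K_Horn : formula -> Prop :=
  | Horn_pos l : pos_lit l -> K_Horn l
  | Horn_neg l : pos_lit l -> K_Horn (Neg l)
  | Horn_clause nabla neg pos :
      all pos_lit neg -> all pos_lit pos -> size pos <= 1 ->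
      K_Horn (boxes nabla (clause neg pos))
  | Horn_and phi psi : K_Horn phi -> K_Horn psi -> K_Horn (And phi psi).

Definition K_Bool : formula -> Prop := fun=> True.

Record model : Type := Model {
  world : Type;
  world_nonempty : inhabited world;
  rel_of : tau -> world -> world -> Prop;
  val_of : world -> P -> Prop
}.

Fixpoint sat (M : model) (w : world M) (phi : formula) : Prop :=
  match phi with
  | Top => True
  | Var p => val_of w p
  | Neg psi => ~ sat w psi
  | Or psi chi => sat w psi \/ sat w chi
  | Dia a psi => exists2 v, rel_of a w v & sat v psi
  | Box a psi => forall v, rel_of a w v -> sat v psi
  end.

End Syntax.

Arguments Top {tau P}.
Arguments Var {tau P} _.
Arguments Bot {tau P}.

(* Codes of partial recursive functions of [n] arguments. *)
Inductive recfn : nat -> Type :=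
  | RZero n : recfn n
  | RSucc : recfn 1
  | RProj n (i : 'I_n) : recfn n
  | RComp m n (g : recfn m) (h : 'I_m -> recfn n) : recfn n
  | RRec n (g : recfn n) (h : recfn n.+2) : recfn n.+1
  | RMu n (g : recfn n.+1) : recfn n.

(* [rec_eval f x z]: the computation of [f] on [x] converges with value [z].
   Primitive recursion is on the first argument; [s k] is its value at [k]. *)
Fixpoint rec_eval (n : nat) (f : recfn n) : n.-tuple nat -> nat -> Prop :=
  match f in recfn n return n.-tuple nat -> nat -> Prop with
  | RZero _ => fun _ z => z = 0
  | RSucc => fun x z => z = (thead x).+1
  | RProj _ i => fun x z => z = tnth x i
  | RComp m _ g h => fun x z =>
      exists2 y : m.-tuple nat,
        forall i, rec_eval (h i) x (tnth y i) & rec_eval g y z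
  | RRec n g h => fun x z =>
      let y : n.-tuple nat := [tuple of behead x] in
      exists s : nat -> nat,
        [/\ rec_eval g y (s 0),
            forall k, k < thead x ->
              rec_eval h [tuple of k :: s k :: y] (s k.+1)
          & z = s (thead x)]
  | RMu _ g => fun x z =>
      rec_eval g [tuple of z :: x] 0 /\
      forall k, k < z -> exists y, rec_eval g [tuple of k :: x] y.+1
  end.

Section Expressivity.

Variables (tau : finType) (P : countType).
Implicit Types L : formula tau P -> Prop.

Definition effective_on L (f : formula tau P -> formula tau P) : Prop :=
  exists e : recfn 1, forall phi, L phi ->
    rec_eval e [tuple pickle phi] (pickle (f phi)).

Definition weak_le L L' : Prop :=
  exists f : formula tau P -> formula tau P,
    [/\ effective_on L f,
        forall phi, L phi -> L' (f phi)
      & forall phi, L phi -> forall (M : model tau P) (w : world M),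
          sat w phi <-> sat w (f phi)].

Definition weak_equiv L L' : Prop := weak_le L L' /\ weak_le L' L.

Definition weak_lt L L' : Prop := weak_le L L' /\ ~ weak_equiv L L'.

End Expressivity.

(* Main.v *)
Require Import Defs.
From mathcomp Require Import all_boot.

(** Take a dead end [Dead], a world [Step] whose only successor is [Dead], a
    reflexive world [Loop], and a world [Fork] with successors [Dead] and [Loop].
    [RootS] sees [Dead], [Step] and [Loop], and [RootL] sees [Fork] in addition.
    Since [Loop] satisfies every positive literal and [Fork] satisfies those common
    to [Dead] and [Step], the two roots satisfy the same positive literals.  As
    moreover every successor of [RootS] is one of [RootL], every clause, boxed or
    not, passes from [RootL] to [RootS].  But the modal formula "some successor has
    both a dead-end successor and a successor that is not a dead end" holds at
    [RootL] only. *)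

Inductive fork_world := Dead | Step | Loop | Fork | RootS | RootL.

Definition fork_edge (w v : fork_world) : bool :=
  match w, v with
  | Step, Dead | Loop, Loop
  | Fork, (Dead | Loop)
  | RootS, (Dead | Step | Loop)
  | RootL, (Dead | Step | Loop | Fork) => true
  | _, _ => false
  end.

Section ForkModel.

Variables (tau : finType) (P : countType).
Implicit Types (l phi psi : formula tau P) (s : seq (formula tau P)).

(* The same relation for all labels and the full valuation, so that the argument
   depends neither on the number of labels nor on the existence of letters. *)
Definition fork_model : model tau P :=
  Model (inhabits Dead) (fun _ w v => fork_edge w v) (fun _ _ => True).

Definition fsat (w : fork_world) phi : Prop := @sat tau P fork_model w phi.

Definition transfers phi : Prop := fsat RootL phi -> fsat RootS phi.

Lemma fsat_Loop l : pos_lit l -> fsat Loop l.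
Proof.
by elim: l => //= a l IH /IH sl; [exists Loop | case].
Qed.

(** A diamond fails at [Dead]; for a box, [Step] supplies the body at [Dead], and [Loop] satisfies
    every positive literal. *)
Lemma fsat_Fork l :
  pos_lit l -> fsat Dead l -> fsat Step l -> fsat Fork l.
Proof.
case: l => //= a l pl; first by move=> [[]].
by move=> _ step [] // _; [apply: step | apply: fsat_Loop].
Qed.

Lemma fsat_Root_lit l : pos_lit l -> fsat RootL l <-> fsat RootS l.
Proof.
case: l => //= a l pl; split.
- by move=> _; exists Loop => //; apply: fsat_Loop.
- by move=> _; exists Loop => //; apply: fsat_Loop.
- by move=> boxl [] // _; apply: boxl.
- by move=> boxl [] // _; do ?[exact: boxl]; apply: fsat_Fork => //; apply: boxl.
Qed.

Lemma transfers_lit l : pos_lit l -> transfers l.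
Proof. by move/fsat_Root_lit=> []. Qed.

Lemma transfers_Neg_lit l : pos_lit l -> transfers (Neg l).
Proof. by move/fsat_Root_lit=> [_ SL] /= nl /SL. Qed.

Lemma transfers_Or phi psi :
  transfers phi -> transfers psi -> transfers (Or phi psi).
Proof. by move=> tphi tpsi [/tphi|/tpsi]; [left | right]. Qed.

Lemma transfers_And phi psi :
  transfers phi -> transfers psi -> transfers (And phi psi).
Proof.
by move=> tphi tpsi /= sL [nS|nS]; apply: sL; [left=> /tphi | right=> /tpsi].
Qed.

Lemma transfers_Box a phi : transfers (Box a phi).
Proof. by move=> boxL [] // _; apply: boxL. Qed.

Lemma transfers_disj s : {in s, forall phi, transfers phi} -> transfers (disj s).
Proof.
case: s => [_ | phi s ts] /=; first exact: transfers_Neg_lit.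
have: transfers phi by apply: ts; rewrite mem_head.
have {ts}: {in s, forall psi, transfers psi}.
  by move=> psi s_psi; apply: ts; rewrite inE s_psi orbT.
(* [disj] folds from the left, so the accumulator [phi] varies in the induction. *)
elim: s phi => //= psi s IH phi ts tphi; apply: IH.
  by move=> chi s_chi; apply: ts; rewrite inE s_chi orbT.
by apply: transfers_Or => //; apply: ts; rewrite mem_head.
Qed.

Lemma transfers_Horn phi : K_Horn phi -> transfers phi.
Proof.
elim=> {phi} [l|l|[|a nabla] neg pos /allP pneg /allP ppos _|phi psi _ tphi _ tpsi].
- exact: transfers_lit.
- exact: transfers_Neg_lit.
- apply: transfers_disj => phi; rewrite mem_cat => /orP[/mapP[l /pneg pl ->]|/ppos].
    exact: transfers_Neg_lit.
  exact: transfers_lit.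
- exact: transfers_Box.
- exact: transfers_And.
Qed.

Definition sees_fork (a : tau) : formula tau P :=
  Dia a (And (Dia a (Neg (Dia a Top))) (Dia a (Dia a Top))).

Lemma fsat_RootL_sees_fork a : fsat RootL (sees_fork a).
Proof.
exists Fork => // -[]; apply.
  by exists Dead => // -[[]].
by exists Loop => //; exists Loop.
Qed.

Lemma fsat_RootS_sees_fork a : ~ fsat RootS (sees_fork a).
Proof.
case=> -[] // _ /=; apply.
(* [Dead] has no successor, the only one of [Step] is a dead end, the only one of [Loop] is not. *)
- by left=> -[[]].
- by right=> -[[] // _ [[]]].
- by left=> -[[] // _ []]; exists Loop.
Qed.

End ForkModel.

Lemma effective_id (tau : finType) (P : countType) (L : formula tau P -> Prop) :
  effective_on L id.
Proof. by exists (RProj ord0). Qed.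

Theorem theorem1 (tau : finType) (P : countType) (htau : 0 < #|tau|) :
  weak_lt (@K_Horn tau P) (@K_Bool tau P).
Proof.
split; first by exists id; split=> //; apply: effective_id.
case=> _ [f [_ f_Horn f_sat]].
have /card_gt0P[a _] := htau.
(* A Horn translation of [sees_fork] would hold at [RootL] but not at [RootS]. *)
have f_satE w := f_sat (sees_fork tau P a) I (fork_model tau P) w.
apply: (@fsat_RootS_sees_fork tau P a); apply/f_satE.
by apply: transfers_Horn; [apply: f_Horn | apply/f_satE/fsat_RootL_sees_fork].
Qed.
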